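(* Let $P$ be any source program (an $\mathsf{asm}$ program satisfying the standing requirements and hypotheses stated in the context), let $\mathcal F(P)$ be its folding, let $n\in\mathbb N$, and let $\sigma$ be an initial source configuration for $P$ and $\tau$ an initial target configuration for $\mathcal F(P)$ with $\sigma \sim_P \tau$. If $\sigma \Rightarrow_s^{\,n} \sigma'$ (an $n$-step source execution of $P$), then there is a target configuration $\tau'$ such that $\tau \Rightarrow_t^{\,n} \tau'$ (an $n$-step target execution of $\mathcal F(P)$) and $\sigma' \sim_P \tau'$.
   Context: **Instructions.** Values $v\in\mathbb V$, registers $x\in\mathbb R$, labels/locations $\ell\in\mathbb L$ (code addresses; each instruction occupies one address). Expressions $e$ are values or registers; $(\!|e|\!)_r$ is the value of $e$ in register map $r$. Common instructions: non-control-flow unary and binary operations $\mathtt{op}_1\,x\,e$ and $\mathtt{op}_2\,x\,e\,e'$ (including loads), $\mathtt{store}\,e\,e'$, $\mathtt{br}\,e\,\ell_t\,\ell_f$, $\mathtt{call}\,\ell$, $\mathtt{ret}$. Source programs may additionally use secret-dependent branches $\mathtt{s.br}\,e\,\ell_t\,\ell_f$ and secret-dependent calls $\mathtt{s.call}\,b\,\ell\,\ell'$ ($b\in\{\top,\bot\}$ immediate; the function at $\ell'$ is the dummy version of the function at $\ell$). Target programs may additionally use level-offset branches $\mathtt{lo.br}\,e\,\mathit{off}_t\,\mathit{off}_f\,\mathit{bbc}$ and level-offset calls $\mathtt{lo.call}\,b\,\ell$. A program $P$ is a partial map from locations to instructions. **Configurations.** Source: $\langle m,r,pc,\rho\rangle$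 with memory $m:\mathbb V\to\mathbb V$, register map $r:\mathbb R\to\mathbb V$, program counter $pc$, stack $\rho$ of return addresses. Target: $\langle m,r,pc,\rho,\lambda\rangle$ where in addition $\lambda$ is a stack of Libra contexts $(\mathit{bbc},\mathit{off})$. Initial configurations have $pc$ at the program's entry point and empty return stack; an initial target configuration has context stack consisting of the single context $(1,0)$. **Semantics.** Non-control-transfer instructions $i$ act deterministically by a relation $\langle m,r\rangle \xrightarrow{i}\langle m',r'\rangle$. Source step $\Rightarrow_s$ (standard): non-control-transfer instructions update $(m,r)$ and set $pc'=pc+1$; $\mathtt{br}$ and $\mathtt{s.br}$ jump to $\ell_t$ if $(\!|e|\!)_r\ne 0$ and to $\ell_f$ otherwise; $\mathtt{call}\,\ell$ pushes $pc+1$ on $\rho$ and jumps to $\ell$; $\mathtt{s.call}\,b\,\ell\,\ell'$ pushes $pc+1$ and jumps to $\ell$ if $b=\top$, to $\ell'$ if $b=\bot$; $\mathtt{ret}$ pops $\rho$ and jumps to the popped address. Target step $\Rightarrow_t$ with context stack $\lambda\cdot(\mathit{bbc},\mathit{off})$: non-control-transfer instructions update $(m,r)$ and set $pc'=pc+\mathit{bbc}$; $\mathtt{br}$ jumps to its label, leaving the contexts unchanged; $\mathtt{lo.br}\,e\,\mathit{off}_t\,\mathit{off}_f\,\mathit{bbc}'$ sets $pc'=(pc-\mathit{off}+\mathit{bbc})+o$ and replaces the top context by $(\mathit{bbc}',o)$, where $o=\mathit{off}_t$ if $(\!|e|\!)_r\neq0$ and $o=\mathit{off}_f$ otherwise;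 $\mathtt{call}\,\ell$ pushes $pc+\mathit{bbc}$ on $\rho$, pushes context $(1,0)$, jumps to $\ell$; $\mathtt{lo.call}\,b\,\ell$ pushes $pc+\mathit{bbc}$ on $\rho$, pushes context $(2,o)$ and jumps to $\ell+o$, where $o=0$ if $b=\top$ and $o=1$ if $b=\bot$; $\mathtt{ret}$ pops $\rho$, jumps to the popped address, and pops the top context. Each step also emits an observation, irrelevant here. $\Rightarrow^{n}$ denotes $n$ steps. **CFG notions.** Programs consist of functions, each with a control-flow graph of basic blocks with unique entry and exit blocks; the last instruction of each block is a terminating instruction ($\mathtt{br}$, $\mathtt{s.br}$ or $\mathtt{ret}$; calls occur inside blocks), and labels point to beginnings of blocks. The secret-dependent region of an $\mathtt{s.br}$ is the set of blocks between the block containing it (the region's entry block) and the immediate postdominator of that block (the region's exit block). The level structure of a region (resp. function) partitions its blocks into levels $L_1,L_2,\dots$ (resp. $L_0,L_1,\dots$) by distance (number of edges of a shortest path) from the region's entry block (resp. the function's entry block). Blocks in a level are indexed from $0$. **Folding $\mathcal F$.** *Rewriting terminators* of level $L_i$ with respect to $L_{i+1}$: each terminator $\mathtt{br}\,e\,\ell_t\,\ell_f$ or $\mathtt{s.br}\,e\,\ell_t\,\ell_f$ becomes $\mathtt{lo.br}\,e\,\mathit{off}_t\,\mathit{off}_f\,|L_{i+1}|$, where $\mathit{off}_t,\mathit{off}_f$ are the indices in $L_{i+1}$ of the blocks at $\ell_t,\ell_f$; $\mathtt{ret}$ is unchanged. *Folding a level* $L=\{B_0,\dots,B_k\}$ of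 equally long blocks yields one block $B'$ with $B'[j\cdot|L|+i]=B_i[j]$; for each $j$, the $|L|$ consecutive instructions $B'[j|L|],\dots,B'[j|L|+|L|-1]$ form a slice of size $|L|$, the $i$-th one being at offset $i$. *Folding a region* with levels $L_1,\dots,L_n$: let $L_0$ be the singleton level of its entry block and $L_{n+1}$ that of its exit block; rewrite terminators and fold each of $L_0,\dots,L_n$. *Folding a function $F$ with its dummy $F'$*: take the componentwise union of the level structures of $F$ and $F'$ (entry block of $F$ at index $0$ and of $F'$ at index $1$ in level $0$), rewrite terminators and fold each level; the result gets a fresh entry label $\ell_{ff'}$. Then $\mathcal F(P)$ is obtained as follows: (1) for each function/dummy pair at $\ell_f,\ell_{f'}$ annotated by an $\mathtt{s.call}$, include the folded function at $\ell_{ff'}$, keeping the original functions too if they can be called by normal calls; (2) replace each outermost secret-dependent region by its folding; (3) copy all other blocks; (4) replace each $\mathtt{s.call}\,b\,\ell_f\,\ell_{f'}$ by $\mathtt{lo.call}\,b\,\ell_{ff'}$; (5) lay out the folded levels of a region or function adjacently in memory, in level order, the exit block of a region coming directly after its last folded level. Labels of $\mathtt{br}$ and $\mathtt{call}$ instructions are mapped to the corresponding (unfolded-function) target locations. Instructions outside folded blocks form slices of size $1$ (offset $0$). **Location correspondence.** $\ell \sim_\ell \ell'$ relates a location $\ell$ of $P$ to each location $\ell'$ of $\mathcal F(P)$ at which $\mathcal F$ places the corresponding instruction; a location in a function that is folded may be related both to a location in the folded function and to one in the kept original function. **Relation $\sim_P$.** $\langle m,r,pc,\rho\rangle \sim_P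 \langle m',r',pc',\rho',\lambda'\rangle$ iff $m=m'$, $r=r'$ and $pc\sim_\ell pc'$. **Standing requirements/hypotheses on $P$.** (i) In a function, blocks of the last level end in $\mathtt{ret}$; (ii) in a secret-dependent region or a function to be folded (with its dummy), all blocks of a given level have the same number of instructions; (iii) in such a region or function, all successors of blocks in level $L_i$ are in level $L_{i+1}$ (the exit block counting as the level after the last level of a region); (iv) $P$ is safe: starting from an initial configuration, $\Rightarrow_s$ does not get stuck; (v) functions are entered only through their entry point and always return to their return site; (vi) secret-dependent regions are single-entry single-exit: entered only through their entry block and exited only through their exit block. *)

(* Defs.v *)
From mathcomp Require Import all_boot.

Set Implicit Arguments.
Unset Strict Implicit.
Unset Printing Implicit Defensive.

(* Code addresses: one instruction per address. *)
Definition loc := nat.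

Inductive expr (V R : Type) := Val of V | Reg of R.

(* The instructions that do not transfer control; loads are operations. *)
Inductive basic (V R O1 O2 : Type) :=
| Op1 of O1 & R & expr V R
| Op2 of O2 & R & expr V R & expr V R
| Store of expr V R & expr V R.

Record machine := Machine {
  value : eqType;
  zero : value;
  reg : Type;
  op1 : Type;
  op2 : Type;
  exec : basic value reg op1 op2 ->
         (value -> value) * (reg -> value) -> (value -> value) * (reg -> value) -> Prop;
  exec_det : forall i c c1 c2, exec i c c1 -> exec i c c2 -> c1 = c2
}.

(* [nsteps R n x y]: x reaches y by exactly n steps of R. *)
Fixpoint nsteps (T : Type) (R : T -> T -> Prop) n (x y : T) : Prop :=
  if n is n'.+1 then exists2 z, R x z & nsteps R n' z y else x = y.

Section Machine.

Variable M : machine.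

Definition mem := value M -> value M.
Definition regs := reg M -> value M.
Definition exp := expr (value M) (reg M).
Definition instr := basic (value M) (reg M) (op1 M) (op2 M).

Definition eval (r : regs) (e : exp) : value M :=
  match e with Val v => v | Reg x => r x end.

(* In [SSCall b l l'] and [TLoCall b l] the immediate top is [true]. *)
Inductive sinstr :=
| SBasic of instr
| SBr of exp & loc & loc
| SCall of loc
| SRet
| SSBr of exp & loc & loc
| SSCall of bool & loc & loc.

(* [TLoBr e off_t off_f bbc]. *)
Inductive tinstr :=
| TBasic of instr
| TBr of exp & loc & loc
| TCall of loc
| TRet
| TLoBr of exp & nat & nat & nat
| TLoCall of bool & loc.

Record sconf := SConf { smem : mem; sreg : regs; spc : loc; sstk : seq loc }.

(* Contexts are pairs (bbc, off); all stacks have their top at the head. *)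
Record tconf := TConf {
  tmem : mem; treg : regs; tpc : loc; tstk : seq loc; tctx : seq (nat * nat) }.

(* A program is the partial map [scode]; the other fields present its functions
   and their control-flow graphs. A block [b] occupies the addresses
   [start b], ..., [start b + len b - 1]. *)
Record sprogram := SProgram {
  scode : loc -> option sinstr;
  sentry : loc;
  blk : finType;
  fn : finType;
  start : blk -> loc;
  len : blk -> nat;
  fun_of : blk -> fn;
  fentry : fn -> blk;
  fexit : fn -> blk
}.

Record tprogram := TProgram { tcode : loc -> option tinstr; tentry : loc }.

Inductive sstep (P : sprogram) : sconf -> sconf -> Prop :=
| SStepBasic m r pc rho i m' r' :
    scode P pc = Some (SBasic i) -> exec i (m, r) (m', r') ->
    sstep P (SConf m r pc rho) (SConf m' r' pc.+1 rho)
| SStepBr m r pc rho e lt lf :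
    scode P pc = Some (SBr e lt lf) ->
    sstep P (SConf m r pc rho)
            (SConf m r (if eval r e != zero M then lt else lf) rho)
| SStepSBr m r pc rho e lt lf :
    scode P pc = Some (SSBr e lt lf) ->
    sstep P (SConf m r pc rho)
            (SConf m r (if eval r e != zero M then lt else lf) rho)
| SStepCall m r pc rho l :
    scode P pc = Some (SCall l) ->
    sstep P (SConf m r pc rho) (SConf m r l (pc.+1 :: rho))
| SStepSCall m r pc rho b l l' :
    scode P pc = Some (SSCall b l l') ->
    sstep P (SConf m r pc rho) (SConf m r (if b then l else l') (pc.+1 :: rho))
| SStepRet m r pc ra rho :
    scode P pc = Some SRet ->
    sstep P (SConf m r pc (ra :: rho)) (SConf m r ra rho).

(* The premise [off <= pc] of [lo.br] makes the truncated subtraction exact. *)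
Inductive tstep (Q : tprogram) : tconf -> tconf -> Prop :=
| TStepBasic m r pc rho bbc off lam i m' r' :
    tcode Q pc = Some (TBasic i) -> exec i (m, r) (m', r') ->
    tstep Q (TConf m r pc rho ((bbc, off) :: lam))
            (TConf m' r' (pc + bbc) rho ((bbc, off) :: lam))
| TStepBr m r pc rho bbc off lam e lt lf :
    tcode Q pc = Some (TBr e lt lf) ->
    tstep Q (TConf m r pc rho ((bbc, off) :: lam))
            (TConf m r (if eval r e != zero M then lt else lf) rho
                   ((bbc, off) :: lam))
| TStepLoBr m r pc rho bbc off lam e offt offf bbc' o :
    tcode Q pc = Some (TLoBr e offt offf bbc') ->
    o = (if eval r e != zero M then offt else offf) ->
    off <= pc ->
    tstep Q (TConf m r pc rho ((bbc, off) :: lam))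
            (TConf m r ((pc - off + bbc) + o) rho ((bbc', o) :: lam))
| TStepCall m r pc rho bbc off lam l :
    tcode Q pc = Some (TCall l) ->
    tstep Q (TConf m r pc rho ((bbc, off) :: lam))
            (TConf m r l (pc + bbc :: rho) ((1, 0) :: (bbc, off) :: lam))
| TStepLoCall m r pc rho bbc off lam b l o :
    tcode Q pc = Some (TLoCall b l) ->
    o = (if b then 0 else 1) ->
    tstep Q (TConf m r pc rho ((bbc, off) :: lam))
            (TConf m r (l + o) (pc + bbc :: rho) ((2, o) :: (bbc, off) :: lam))
| TStepRet m r pc ra rho bbc off lam :
    tcode Q pc = Some TRet ->
    tstep Q (TConf m r pc (ra :: rho) ((bbc, off) :: lam))
            (TConf m r ra rho lam).

Definition sinit (P : sprogram) (s : sconf) : Prop :=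
  spc s = sentry P /\ sstk s = [::].

Definition tinit (Q : tprogram) (t : tconf) : Prop :=
  [/\ tpc t = tentry Q, tstk t = [::] & tctx t = [:: (1, 0)]].

Definition is_term (i : sinstr) : bool :=
  match i with SBr _ _ _ | SSBr _ _ _ | SRet => true | _ => false end.

Definition br_labels (i : sinstr) : seq loc :=
  match i with SBr _ lt lf | SSBr _ lt lf => [:: lt; lf] | _ => [::] end.

Definition call_labels (i : sinstr) : seq loc :=
  match i with SCall l => [:: l] | SSCall _ l l' => [:: l; l'] | _ => [::] end.

Definition callee (i : sinstr) : option loc :=
  match i with
  | SCall l => Some l
  | SSCall b l l' => Some (if b then l else l')
  | _ => None
  end.

Section CFG.

Variable P : sprogram.

Definition in_block (b : blk P) (l : loc) : bool :=
  start b <= l < start b + len b.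

Definition flabel (f : fn P) : loc := start (fentry f).

Definition term (b : blk P) : option sinstr := scode P (start b + (len b).-1).

Definition is_sbr (b : blk P) : bool :=
  if term b is Some (SSBr _ _ _) then true else false.

Definition edge : rel (blk P) :=
  fun b c => if term b is Some i then start c \in br_labels i else false.

Record wf_cfg : Prop := WfCfg {
  wf_dom : forall l, scode P l <> None <-> exists b : blk P, in_block b l;
  wf_disj : forall (b c : blk P) l, in_block b l -> in_block c l -> b = c;
  wf_len : forall b : blk P, 0 < len b;
  wf_term : forall (b : blk P) j i, j < len b -> scode P (start b + j) = Some i ->
    is_term i = (j.+1 == len b);
  wf_entry : forall f : fn P, fun_of (fentry f) = f;
  wf_fexit : forall f : fn P, fun_of (fexit f) = f;
  wf_exit : forall b : blk P, term b = Some SRet <-> b = fexit (fun_of b);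
  (* Every block has a distance from the entry block of its function. *)
  wf_reach : forall b : blk P, connect edge (fentry (fun_of b)) b;
  wf_start : exists f, sentry P = flabel f
}.

Definition walk (n : nat) (x y : blk P) : bool :=
  [exists p : n.-tuple (blk P), path edge x p && (last x p == y)].

(* Length of a shortest path, necessarily smaller than the number of blocks;
   the junk value for an unreachable [y] is #|blk P|. *)
Definition dist (x y : blk P) : nat :=
  find (fun n => walk n x y) (iota 0 #|blk P|).

(* [pdom y x]: y postdominates x. Asking that the exit block be reachable from
   x excludes the vacuous case in which every block would postdominate x. *)
Definition pdom (y x : blk P) : Prop :=
  let ex := fexit (fun_of x) in
  connect edge x ex /\ forall p, path edge x p -> last x p = ex -> y \in x :: p.

Definition ipdom (y x : blk P) : Prop :=
  [/\ y <> x, pdom y x & forall z, z <> x -> pdom z x -> pdom z y].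

(* The blocks reached from E without going through X. *)
Definition region (E X : blk P) : {set blk P} :=
  [set b | [&& b != E, b != X & connect [rel x y | edge x y && (y != X)] E b]].

(* [is_region E X]: E and X are the entry and exit block of the
   secret-dependent region of the s.br that terminates E. *)
Definition is_region (E X : blk P) : Prop := is_sbr E /\ ipdom X E.

Definition rdepth (E X : blk P) : nat := \max_(b in region E X) dist E b.

(* Levels L_0 = {E}, L_1, ..., L_n, L_(n+1) = {X}, with n = rdepth E X. *)
Definition rlevel (E X : blk P) (i : nat) : seq (blk P) :=
  if i == (rdepth E X).+1 then [:: X]
  else enum [set b in E |: region E X | dist E b == i].

Definition fdepth (f : fn P) : nat :=
  \max_(b | fun_of b == f) dist (fentry f) b.

Definition flevel (f : fn P) (i : nat) : seq (blk P) :=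
  enum [set b | (fun_of b == f) && (dist (fentry f) b == i)].

(* [is_pair f f']: some s.call gives f' as the dummy version of f. *)
Definition is_pair (f f' : fn P) : Prop :=
  exists l b, scode P l = Some (SSCall b (flabel f) (flabel f')).

(* Concatenation puts the entry blocks of f and f' at indices 0 and 1. *)
Definition plevel (f f' : fn P) (i : nat) : seq (blk P) :=
  flevel f i ++ flevel f' i.

Definition ret_last_level : Prop :=
  forall (f : fn P) b, fun_of b = f -> dist (fentry f) b = fdepth f -> term b = Some SRet.

Definition equal_lengths : Prop :=
  (forall E X i, is_region E X ->
     {in rlevel E X i &, forall b c, len b = len c}) /\
  (forall f f' i, is_pair f f' ->
     {in plevel f f' i &, forall b c, len b = len c}).

Definition level_succ : Prop :=
  (forall E X i, is_region E X -> i <= rdepth E X ->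
     {in rlevel E X i, forall b c, edge b c -> c \in rlevel E X i.+1}) /\
  (forall f f', is_pair f f' -> forall g, g = f \/ g = f' ->
     forall i, {in flevel g i, forall b c, edge b c -> c \in flevel g i.+1}).

Definition sreachable (s : sconf) : Prop :=
  exists s0 n, sinit P s0 /\ nsteps (sstep P) n s0 s.

Definition safe : Prop := forall s, sreachable s -> exists s', sstep P s s'.

Record fun_discipline : Prop := FunDiscipline {
  fd_br : forall b i l, term b = Some i -> l \in br_labels i ->
    exists c, fun_of c = fun_of b /\ start c = l;
  fd_call : forall pc i l, scode P pc = Some i -> l \in call_labels i ->
    exists f, flabel f = l;
  (* A return goes to the address following a call of the current function. *)
  fd_ret : forall s ra rho,
    sreachable s -> scode P (spc s) = Some SRet -> sstk s = ra :: rho ->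
    exists pc i b, [/\ ra = pc.+1, scode P pc = Some i, in_block b (spc s) &
                       callee i = Some (flabel (fun_of b))]
}.

Record sese (E X : blk P) : Prop := Sese {
  sese_call : forall f : fn P, fentry f \notin region E X;
  sese_in : forall a b, b \in region E X -> edge a b -> a \in E |: region E X;
  sese_out : forall a b, a \in region E X -> edge a b -> b \in X |: region E X
}.

Record standing : Prop := Standing {
  st_cfg : wf_cfg;
  st_regions : forall E, is_sbr E -> exists X, is_region E X;
  st_ret : ret_last_level;
  st_len : equal_lengths;
  st_succ : level_succ;
  st_safe : safe;
  st_fun : fun_discipline;
  st_sese : forall E X, is_region E X -> sese E X
}.

(* Placement of the target code: [unf] maps the label of a block that is not
   inside a folded block to its target location, and [ffl] maps the labels of a
   function and of its dummy to the entry label of their folding. *)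
Record layout := Layout { unf : loc -> loc; ffl : loc -> loc -> loc }.

(* Number of instructions of the folding of the level [L]. *)
Definition lsize (L : seq (blk P)) : nat := \sum_(b <- L) len b.

Definition in_region (b : blk P) : Prop :=
  exists E X, is_region E X /\ b \in region E X.

Definition outermost (E X : blk P) : Prop := is_region E X /\ ~ in_region E.

(* The functions that occur unfolded in the target program. The entry point is
   also reached without an s.call. *)
Definition kept (f : fn P) : Prop :=
  [\/ sentry P = flabel f,
      exists l, scode P l = Some (SCall (flabel f))
    | forall g, ~ is_pair f g /\ ~ is_pair g f].

Variable ly : layout.

(* [chunk a L N]: the target program has at address [a] the folding of the
   level [L], with terminators rewritten with respect to the level [N'] if
   [N = Some N'], and copied (with relocated labels) if [N = None]. *)
Inductive chunk : loc -> seq (blk P) -> option (seq (blk P)) -> Prop :=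
| ChunkFun f f' i :
    is_pair f f' ->
    chunk (ffl ly (flabel f) (flabel f') + \sum_(j < i) lsize (plevel f f' j))
          (plevel f f' i) (Some (plevel f f' i.+1))
| ChunkRegion E X i :
    kept (fun_of E) -> outermost E X -> i <= rdepth E X ->
    chunk (unf ly (start E) + \sum_(j < i) lsize (rlevel E X j))
          (rlevel E X i) (Some (rlevel E X i.+1))
| ChunkCopy b :
    kept (fun_of b) -> ~~ is_sbr b -> ~ in_region b ->
    chunk (unf ly (start b)) [:: b] None.

(* [placed l l' N]: the instruction of P at [l] is placed at [l'], in a chunk
   whose terminators are rewritten with respect to [N]. *)
Inductive placed (l l' : loc) (N : option (seq (blk P))) : Prop :=
| Placed a L k b j :
    chunk a L N -> onth L k = Some b -> j < len b ->
    l = start b + j -> l' = a + (j * size L + k) -> placed l l' N.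

Definition loc_corr (l l' : loc) : Prop := exists N, placed l l' N.

Definition level_index (N : seq (blk P)) (l : loc) : nat :=
  index l (map (@start P) N).

(* No s.br terminates a copied block. *)
Definition rewrite_instr (N : option (seq (blk P))) (i : sinstr) :
    option tinstr :=
  match i with
  | SBasic j => Some (TBasic j)
  | SCall l => Some (TCall (unf ly l))
  | SSCall b l l' => Some (TLoCall b (ffl ly l l'))
  | SRet => Some TRet
  | SBr e lt lf =>
      if N is Some N' then
        Some (TLoBr e (level_index N' lt) (level_index N' lf) (size N'))
      else Some (TBr e (unf ly lt) (unf ly lf))
  | SSBr e lt lf =>
      if N is Some N' then
        Some (TLoBr e (level_index N' lt) (level_index N' lf) (size N'))
      else None
  end.

(* [is_folding Q]: Q is the folding of P with its code placed according to the
   layout. *)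
Record is_folding (Q : tprogram) : Prop := IsFolding {
  fold_entry : tentry Q = unf ly (sentry P);
  fold_code : forall l' i', tcode Q l' = Some i' <->
    exists l i N, [/\ placed l l' N, scode P l = Some i &
                      rewrite_instr N i = Some i'];
  fold_exit : forall E X, kept (fun_of E) -> outermost E X ->
    unf ly (start X) =
    unf ly (start E) + \sum_(j < (rdepth E X).+1) lsize (rlevel E X j);
  fold_disj : forall a1 L1 N1 a2 L2 N2 l,
    chunk a1 L1 N1 -> chunk a2 L2 N2 ->
    a1 <= l < a1 + lsize L1 -> a2 <= l < a2 + lsize L2 ->
    (a1, L1, N1) = (a2, L2, N2)
}.

Definition sim (s : sconf) (t : tconf) : Prop :=
  [/\ smem s = tmem t, sreg s = treg t & loc_corr (spc s) (tpc t)].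

End CFG.

End Machine.

(* Main.v *)
(* A folded execution runs in lockstep with the source execution because the top
   Libra context always equals the pair (size of the current level, index of the
   current block in it), and every saved return address is paired with the
   context that will be restored on return. Inside a folded level the invariant
   is kept by level_succ and equal_lengths: the slice following the terminators
   is the first slice of the next level. When an outermost region is left, its
   exit block must itself be laid out unfolded, i.e. lie in no region; this holds
   because two secret-dependent regions cannot overlap without being nested, by
   antisymmetry of postdominance. *)
Require Import Defs.
From mathcomp Require Import all_boot.

Set Implicit Arguments.
Unset Strict Implicit.
Unset Printing Implicit Defensive.

Section Folding.

Variables (M : machine) (P : sprogram M).

Implicit Types (b c E X : blk P) (f g : fn P).

(** * Distances and levels *)

Lemma dist_eq0 b c : (dist b c == 0) = (b == c).
Proof.
(* The search range is nonempty, so the search starts with walks of length 0. *)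
rewrite /dist; have: 0 < #|blk P| by apply/card_gt0P; exists b.
case: #|blk P| => // n _ /=.
have -> : walk 0 b c = (b == c).
  apply/existsP/idP => [[p]|/eqP->]; first by rewrite tuple0.
  by exists [tuple]; rewrite /= eqxx.
by case: (b == c).
Qed.

Lemma rlevel0 E X : rlevel E X 0 = [:: E].
Proof.
rewrite /rlevel /= -[RHS]enum_set1; apply: eq_enum => b.
rewrite !inE dist_eq0 [E == b]eq_sym.
by case: (b == E); rewrite ?andbF.
Qed.

Lemma rlevel_last E X : rlevel E X (rdepth E X).+1 = [:: X].
Proof. by rewrite /rlevel eqxx. Qed.

Lemma mem_rlevel E X i b :
  i <= rdepth E X -> b \in rlevel E X i -> b \in E |: region E X.
Proof.
move=> le_i; rewrite /rlevel ltn_eqF ?ltnS // mem_enum inE.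
by case/andP.
Qed.

Lemma flevel0 f : fun_of (fentry f) = f -> flevel f 0 = [:: fentry f].
Proof.
move=> fE; rewrite /flevel -[RHS]enum_set1; apply: eq_enum => b.
rewrite !inE dist_eq0 [b == _]eq_sym.
by case: (fentry f =P b) => [<-|]; rewrite ?fE ?eqxx ?andbF.
Qed.

Lemma lsizeE (L : seq (blk P)) b :
  {in L &, forall c c', len c = len c'} -> b \in L ->
  lsize L = len b * size L.
Proof.
move=> eqL bL; rewrite /lsize (eq_big_seq (fun=> len b)); last first.
  by move=> c cL; apply: eqL.
by rewrite big_const_seq iter_addn_0 count_predT.
Qed.

(** * Postdominance and secret-dependent regions *)

Lemma path_avoid X b p :
  path [rel x y | edge x y && (y != X)] b p = path (@edge M P) b p && (X \notin p).
Proof.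
elim: p b => //= c p IH b; rewrite IH inE negb_or [X == c]eq_sym.
by rewrite andbACA.
Qed.

(** On a duplicate-free path from [b] to the exit, [c] occurs; if it differs from [b], the rest of
    the path from [c] would have to visit [b] a second time. *)
Lemma pdom_anti b c :
  fun_of b = fun_of c -> pdom b c -> pdom c b -> b = c.
Proof.
move=> eqf [_ dom_bc] [/connectP[p0 p0P p0L] dom_cb].
case/shortenP: p0P p0L => p pP pU _ pL.
have := dom_cb p pP (esym pL); rewrite inE => /predU1P[-> //|c_p].
case/splitPr: c_p pP pU pL => p1 p2; rewrite cat_path last_cat /=.
case/and3P=> _ _ p2P /andP[bN _] p2L.
have := dom_bc p2 p2P; rewrite -eqf => /(_ (esym p2L)) b_p2.
by rewrite mem_cat b_p2 orbT in bN.
Qed.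

Lemma exit_notin_region E X : is_region E X -> fexit (fun_of E) \notin region E X.
Proof.
case=> _ [XnE [_ domX] _]; apply/negP; rewrite !inE => /and3P[_ _].
case/connectP => p; rewrite path_avoid => /andP[pP XNp] pL.
have := domX p pP (esym pL); rewrite inE (negbTE XNp) orbF.
by move/eqP.
Qed.

Hypothesis st : standing P.

Lemma block_start_inj b c : start b = start c -> b = c.
Proof.
have cfg := st_cfg st.
move=> eqs; apply: (wf_disj cfg (l := start b)).
  by rewrite /in_block leqnn -[X in X < _]addn0 ltn_add2l (wf_len cfg).
by rewrite /in_block eqs leqnn -[X in X < _]addn0 ltn_add2l (wf_len cfg).
Qed.

Lemma edge_fun b c : edge b c -> fun_of c = fun_of b.
Proof.
rewrite /edge; case tb: (term b) => [i|//] ci.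
have [c' [<- /block_start_inj -> //]] := fd_br (st_fun st) tb ci.
Qed.

Lemma connect_fun b c : connect (@edge M P) b c -> fun_of c = fun_of b.
Proof.
case/connectP => p; elim: p b => [|d p IH] b /=; first by move=> _ ->.
by case/andP=> /edge_fun <- pP /(IH _ pP).
Qed.

Lemma region_fun E X b : b \in E |: region E X -> fun_of b = fun_of E.
Proof.
rewrite !inE => /predU1P[-> //|/and3P[_ _ /connectP[p]]].
rewrite path_avoid => /andP[pP _] pL; apply: connect_fun.
by apply/connectP; exists p.
Qed.

Lemma pdom_region E X b :
  is_region E X -> b \in region E X ->
  connect (@edge M P) b (fexit (fun_of b)) -> pdom X b.
Proof.
move=> regE bE cb; split=> // p.
have -> : fun_of b = fun_of E by apply: (@region_fun E X); rewrite inE bE orbT.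
elim: p b bE {cb} => [|c p IH] b bE /=.
  by move=> _ eb; rewrite eb (negbTE (exit_notin_region regE)) in bE.
case/andP=> bc pP pL; have := sese_out (st_sese st regE) bE bc.
rewrite inE in_set1 => /predU1P[<-|cE]; first by rewrite !inE eqxx orbT.
by rewrite inE IH ?orbT.
Qed.

(** Tracing the path back from [c], each predecessor of a region block is [E] or again in the
    region. A general subrelation [e] lets the path to [E] keep properties such as avoiding a
    block. *)
Lemma connect_region_entry (e : rel (blk P)) E X b c :
  subrel e (@edge M P) -> is_region E X ->
  b \notin region E X -> c \in region E X -> connect e b c -> connect e b E.
Proof.
move=> sub regE bN cE /connectP[p]; elim/last_ind: p c cE => [|p d IH] c cE.
  by move=> _ /= ec; rewrite -ec cE in bN.
rewrite rcons_path last_rcons => /andP[pP e_d] ed; rewrite -{d}ed in e_d.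
have := sese_in (st_sese st regE) cE (sub _ _ e_d).
rewrite inE in_set1 => /predU1P[<-|lE]; last exact: IH lE pP erefl.
by apply/connectP; exists p.
Qed.

(** If [X] lay in a region with entry [E'] and exit [X'], then [X'] would postdominate [X].
    Conversely [X] would postdominate [E'], hence also its immediate postdominator [X'].
    Antisymmetry gives [X = X'], but an exit block is outside its own region. *)
Lemma outermost_exit E X b :
  outermost E X -> b \in E |: region E X -> edge b X -> ~ in_region X.
Proof.
case=> regE EN bE bX [E' [X' [regE' XE']]].
have EN' : E \notin region E' X' by apply/negP => EE'; apply: EN; exists E', X'.
have [_ [XE [cE domX] domE]] := regE.
have [_ [XE'' domX' domE']] := regE'.
have fX : fun_of X = fun_of E by rewrite (edge_fun bX) (region_fun bE).
have cX : connect (@edge M P) X (fexit (fun_of X)).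
  rewrite fX; case/connectP: cE => p pP pL.
  have := domX p pP (esym pL); rewrite inE (negbTE (introN eqP XE)) /=.
  move=> Xp; case/splitPr: Xp pP pL => p1 p2.
  rewrite cat_path last_cat /= => /and3P[_ _ p2P] p2L.
  by apply/connectP; exists p2.
have domX'X := pdom_region regE' XE' cX.
have fXE' : fun_of X = fun_of E' by apply: (@region_fun E' X'); rewrite inE XE' orbT.
have fX' : fun_of X' = fun_of X.
  case: domX'X => /connectP[p pP pL] /(_ p pP (esym pL)).
  by move/(path_connect pP)/connect_fun.
have XX' : X <> X' by move: XE'; rewrite !inE => /and3P[_ /eqP].
apply: XX'; apply: pdom_anti => //.
have [eqE | neE] := eqVneq E' E.
  by apply: domE'; [rewrite eqE | rewrite eqE; split].
(* The path from [E] to [b] avoiding [X] starts outside the region of [E'], as [E] is outermost, and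
   ends at [E'] or inside that region; so it meets [E']. *)
have E'E : E' \in region E X.
  have : connect [rel x y | edge x y && (y != X)] E E'.
    have sub : subrel [rel x y | edge x y && (y != X)] (@edge M P).
      by move=> x y /andP[].
    have := sese_in (st_sese st regE') XE' bX.
    have cEb : connect [rel x y | edge x y && (y != X)] E b.
      by move: bE; rewrite !inE => /predU1P[-> //|/and3P[]].
    rewrite inE in_set1 => /predU1P[<- //|bE'].
    exact: connect_region_entry sub regE' EN' bE' cEb.
  move=> cEE'; rewrite !inE neE cEE' andbT /=.
  by apply/eqP => eqE'; move: XE'; rewrite !inE -eqE' eqxx.
apply: domE'; first by move=> eqX; move: E'E; rewrite !inE eqX eqxx andbF.
by apply: pdom_region regE E'E _; case: domX'.
Qed.

(** * Target addresses and their Libra contexts *)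

Variables (ly : layout) (Q : tprogram M).

(** Strengthens [loc_corr], which is silent on contexts, by the context that execution must carry at
    [l']: slice size and offset. *)
Inductive slot (l l' : loc) (ctx : nat * nat) : Prop :=
| Slot a L N k b j of
    chunk ly a L N & onth L k = Some b & j < len b &
    l = start b + j & l' = a + (j * size L + k) & ctx = (size L, k).

Lemma slot_corr l l' ctx : slot l l' ctx -> loc_corr P ly l l'.
Proof.
by case=> a L N k b j chL kb jb lE l'E _; exists N; apply: Placed chL kb jb lE l'E.
Qed.

(** A block ending in an s.br is the singleton level 0 of an outermost region; any other such block
    is copied. Both yield slices of size 1. *)
Lemma slot_unfolded b :
  kept (fun_of b) -> ~ in_region b -> slot (start b) (unf ly (start b)) (1, 0).
Proof.
move=> kb nb; have b0 := wf_len (st_cfg st) b.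
case sb: (is_sbr b).
  have [X regX] := st_regions st sb.
  have := @ChunkRegion _ _ ly b X 0 kb (conj regX nb) isT.
  rewrite big_ord0 addn0 rlevel0 => ch.
  by apply: (Slot (k := 0) (b := b) ch erefl b0); rewrite ?addn0.
have ch := ChunkCopy ly kb (negbT sb) nb.
by apply: (Slot (k := 0) (b := b) ch erefl b0); rewrite ?addn0.
Qed.

Lemma slot_fentry f : kept f -> slot (flabel f) (unf ly (flabel f)) (1, 0).
Proof.
move=> kf; apply: slot_unfolded; first by rewrite (wf_entry (st_cfg st)).
case=> E [X [regE]]; apply/negP; exact: sese_call (st_sese st regE) f.
Qed.

Lemma slot_pair f g (d : bool) : is_pair f g ->
  slot (if d then flabel f else flabel g)
       (ffl ly (flabel f) (flabel g) + (if d then 0 else 1))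
       (2, if d then 0 else 1).
Proof.
move=> fg; have cfg := st_cfg st.
have := ChunkFun ly 0 fg.
rewrite big_ord0 addn0 {1}/plevel !flevel0 ?(wf_entry cfg) //= => ch.
apply: (Slot (k := if d then 0 else 1) (b := if d then fentry f else fentry g)
             ch _ (wf_len cfg _));
  by case: d; rewrite ?addn0.
Qed.

Lemma slot_index a L N c :
  chunk ly a L N -> c \in L ->
  slot (start c) (a + level_index L (start c)) (size L, level_index L (start c)).
Proof.
move=> ch cL; rewrite /level_index index_map; last exact: block_start_inj.
have lt_c : index c L < size L by rewrite index_mem.
apply: (Slot (k := index c L) (b := c) ch _ (wf_len (st_cfg st) c)) => //.
  by rewrite onthE (nth_map c) // nth_index.
by rewrite addn0.
Qed.

(** In a folding, the next level lies directly behind the current one, and [level_succ] puts the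
    successor block in it. *)
Lemma chunk_succ a L N b c :
  is_folding P ly Q -> chunk ly a L N -> b \in L -> edge b c ->
  if N is Some L' then
    lsize L = len b * size L /\
    slot (start c) (a + lsize L + level_index L' (start c))
         (size L', level_index L' (start c))
  else [/\ ~~ is_sbr b, size L = 1 & slot (start c) (unf ly (start c)) (1, 0)].
Proof.
move=> fold; have [lenR lenF] := st_len st; have [succR succF] := st_succ st.
case=> [f f' i ff' | E X i kE out le_i | b' kb' nsb nreg] bL bc.
- split; first by apply: lsizeE bL; apply: lenF.
  have := ChunkFun ly i.+1 ff'; rewrite big_ord_recr /= addnA => ch.
  apply: slot_index ch _; move: bL; rewrite /plevel !mem_cat.
  case/orP=> bL; [apply/orP; left | apply/orP; right];
    by apply: (succF _ _ ff') bL _ bc; auto.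
- have [regE nE] := out.
  split; first by apply: lsizeE bL; apply: lenR regE.
  have cL := succR _ _ _ regE le_i _ bL _ bc.
  have bE := mem_rlevel le_i bL.
  case: (ltngtP i (rdepth E X)) le_i => // [lt_i | eq_i] _.
    have := ChunkRegion ly kE out lt_i; rewrite big_ord_recr /= => ch.
    by have := slot_index ch cL; rewrite !addnA.
  (* Behind the last level comes the singleton level of [X], with index 0; [fold_exit] makes this
     address the unfolded location of [X]. *)
  move: cL; rewrite eq_i rlevel_last inE => /eqP eqc; rewrite {c}eqc in bc *.
  rewrite /level_index /= eqxx addn0.
  have := fold_exit fold kE out; rewrite big_ord_recr /= addnA => <-.
  apply: slot_unfolded; last exact: outermost_exit out bE bc.
  by rewrite (edge_fun bc) (region_fun bE).
- move: bL; rewrite inE => /eqP eqb; rewrite {b}eqb in bc *.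
  split=> //; apply: slot_unfolded; first by rewrite (edge_fun bc).
  (* An edge into a region starts at its entry block or inside it, whereas a copied block does not
     end in an s.br and lies in no region. *)
  case=> E [X [regE cE]].
  have := sese_in (st_sese st regE) cE bc; rewrite inE in_set1.
  case/predU1P=> [eqE | bE]; last by apply: nreg; exists E, X.
  by case: regE; rewrite -eqE (negbTE nsb).
Qed.

(** * The lockstep simulation *)

Inductive frames : seq loc -> seq loc -> seq (nat * nat) -> Prop :=
| FramesNil : frames [::] [::] [::]
| FramesCons ra ra' ctx rho rho' lam :
    slot ra ra' ctx -> frames rho rho' lam ->
    frames (ra :: rho) (ra' :: rho') (ctx :: lam).

Definition lockstep (s : sconf M) (t : tconf M) : Prop :=
  exists ctx lam,
    [/\ smem s = tmem t, sreg s = treg t, tctx t = ctx :: lam,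
        slot (spc s) (tpc t) ctx & frames (sstk s) (tstk t) lam].

Lemma lockstep_sim s t : lockstep s t -> sim P ly s t.
Proof. by case=> ctx [lam [eqm eqr _ /slot_corr]]. Qed.

Hypothesis fold : is_folding P ly Q.

Lemma slot_code l a L N k b j i i' :
  chunk ly a L N -> onth L k = Some b -> j < len b -> l = start b + j ->
  scode P l = Some i -> rewrite_instr ly N i = Some i' ->
  tcode Q (a + (j * size L + k)) = Some i'.
Proof.
move=> ch kb jb lE li ii'; apply/(fold_code fold); exists l, i, N.
by split=> //; apply: Placed ch kb jb lE erefl.
Qed.

(** Successive instructions of a block lie one slice apart, and [bbc] is the slice size. [N] may
    stay abstract, as it affects only the rewriting of branches. *)
Lemma slot_next l l' bbc off i :
  slot l l' (bbc, off) -> scode P l = Some i -> ~~ is_term i ->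
  slot l.+1 (l' + bbc) (bbc, off) /\
  exists N : option (seq (blk P)),
    forall i', rewrite_instr ly N i = Some i' -> tcode Q l' = Some i'.
Proof.
case=> a L N k b j ch kb jb lE l'E ctxE li nti.
split; last first.
  by exists N => i' ii'; rewrite l'E; apply: slot_code ch kb jb lE li ii'.
case: ctxE => -> ->.
have := wf_term (st_cfg st) jb; rewrite -lE => /(_ _ li).
rewrite (negbTE nti) => /esym/negbT jN.
apply: (Slot (j := j.+1) ch kb); rewrite ?lE ?l'E ?addnS //.
  by rewrite ltn_neqAle jN.
by rewrite mulSn -addnA -[in RHS]addnA [X in a + X]addnC.
Qed.

Lemma branch_step m r pc pc' rho' bbc off lam e lt lf i :
  scode P pc = Some i -> i = SBr e lt lf \/ i = SSBr e lt lf ->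
  slot pc pc' (bbc, off) ->
  let l := if eval r e != zero M then lt else lf in
  exists l' ctx, slot l l' ctx /\
    tstep Q (TConf m r pc' rho' ((bbc, off) :: lam))
            (TConf m r l' rho' (ctx :: lam)).
Proof.
move=> li ibr [a L N k b j ch kb jb lE l'E [-> ->]] l.
have ti : is_term i by case: ibr => ->.
have lbr : l \in br_labels i.
  by case: ibr => ->; rewrite !inE /l; case: ifP; rewrite eqxx ?orbT.
have := wf_term (st_cfg st) jb; rewrite -lE => /(_ _ li).
rewrite ti => /esym/eqP jE.
have tb : term b = Some i by rewrite /term -jE /= -lE.
have [c [_ cl]] := fd_br (st_fun st) tb lbr.
have bc : edge b c by rewrite /edge tb cl.
have bL : b \in L by apply/onthP; exists k.
have := chunk_succ fold ch bL bc; rewrite cl.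
case: N ch => [L'|] ch; last first.
  rewrite /is_sbr tb => -[nsb sL sl]; case: ibr nsb => eqi; subst i => // _.
  have := slot_code ch kb jb lE li erefl; rewrite -l'E => code.
  exists (unf ly l), (1, 0); split=> //.
  (* The slice has size 1, so the context that [br] leaves unchanged is already [(1, 0)]. *)
  have k0 : k = 0.
    by have := onthTE L k; rewrite kb sL ltnS leqn0 => /esym/eqP.
  have := TStepBr m r rho' 1 0 lam code.
  by rewrite sL k0 /l; case: ifP.
case=> eqLs sl.
set o := level_index L' l in sl.
have code : tcode Q pc' =
    Some (TLoBr e (level_index L' lt) (level_index L' lf) (size L')).
  by rewrite l'E; apply: slot_code ch kb jb lE li _; case: ibr => ->.
exists (a + lsize L + o), (size L', o); split=> //.
have le_k : k <= pc' by rewrite l'E addnA leq_addl.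
(* [pc' - k] is the address of the last slice of the level; one slice further is the end of the
   level. *)
have -> : a + lsize L + o = pc' - k + size L + o.
  rewrite l'E addnA addnK eqLs; congr (_ + _).
  by rewrite -jE mulSnr addnA.
apply: TStepLoBr code _ le_k.
by rewrite /o /l; case: ifP.
Qed.

Lemma lockstep_step s s' t :
  lockstep s t -> sstep P s s' -> exists2 t', tstep Q t t' & lockstep s' t'.
Proof.
case: t => m0 r0 pc' rho' lam0 [[bbc off] [lam []]] /= em er -> sl fr step.
case: step em er sl fr => /=.
- move=> m r pc rho i m' r' code ex em er sl fr; rewrite {m}em {r}er in ex.
  have [sl' [N tc]] := slot_next sl code isT.
  exists (TConf m' r' (pc' + bbc) rho' ((bbc, off) :: lam)).
    by apply: TStepBasic ex; apply: tc.
  by exists (bbc, off), lam.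
- move=> m r pc rho e lt lf code -> -> sl fr.
  have [l' [ctx [sl' ts]]] :=
    branch_step m0 r0 rho' lam code (or_introl erefl) sl.
  by eexists; first exact: ts; exists ctx, lam.
- move=> m r pc rho e lt lf code -> -> sl fr.
  have [l' [ctx [sl' ts]]] :=
    branch_step m0 r0 rho' lam code (or_intror erefl) sl.
  by eexists; first exact: ts; exists ctx, lam.
- move=> m r pc rho l code -> -> sl fr.
  have [sl' [N tc]] := slot_next sl code isT.
  have [|f fl] := fd_call (st_fun st) (l := l) code; first by rewrite inE.
  rewrite -{l}fl in code tc *.
  eexists; first by apply: TStepCall; apply: tc.
  (* The caller's context is paired with the return site, where [sl'] shows that it fits. *)
  exists (1, 0), ((bbc, off) :: lam); split=> //=; last exact: FramesCons.
  by apply: slot_fentry; apply: Or32; exists pc.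
- move=> m r pc rho d l1 l2 code -> -> sl fr.
  have [sl' [N tc]] := slot_next sl code isT.
  have [|f fl] := fd_call (st_fun st) (l := l1) code; first by rewrite !inE eqxx.
  have [|g gl] := fd_call (st_fun st) (l := l2) code; first by rewrite !inE eqxx orbT.
  rewrite -{l1}fl -{l2}gl in code tc *.
  eexists; first by apply: TStepLoCall; first exact: tc.
  exists (2, if d then 0 else 1), ((bbc, off) :: lam).
  split=> //=; last exact: FramesCons.
  by apply: slot_pair; exists pc, d.
- move=> m r pc ra rho code -> -> sl fr.
  have code' : tcode Q pc' = Some (TRet M).
    case: sl => a L N k b j ch kb jb lE -> _.
    exact: slot_code ch kb jb lE code erefl.
  (* Popping the context uncovers exactly the one that [fr] pairs with the return address. *)
  inversion fr as [|ra0 ra' ctx rho0 rho1 lam1 sl' fr']; subst.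
  by eexists; first exact: TStepRet code'; exists ctx, lam1.
Qed.

Lemma lockstep_nsteps n s s' t :
  lockstep s t -> nsteps (sstep P) n s s' ->
  exists2 t', nsteps (tstep Q) n t t' & lockstep s' t'.
Proof.
elim: n s t => [|n IH] s t ls /=; first by move=> <-; exists t.
case=> s1 ss1 s1s'; have [t1 tt1 ls1] := lockstep_step ls ss1.
have [t' t1t' ls'] := IH _ _ ls1 s1s'.
by exists t' => //; exists t1.
Qed.

End Folding.

Theorem proposition5p1 (M : machine) (P : sprogram M) (ly : layout)
    (Q : tprogram M) (n : nat) (sigma sigma' : sconf M) (tau : tconf M) :
  standing P ->
  is_folding P ly Q ->
  sinit P sigma -> tinit Q tau -> sim P ly sigma tau ->
  nsteps (sstep P) n sigma sigma' ->
  exists tau' : tconf M,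
    nsteps (tstep Q) n tau tau' /\ sim P ly sigma' tau'.
Proof.
move=> st fold [spcE sstkE] [tpcE tstkE tctxE] [em er _] steps.
(* The entry function is kept, so execution starts in a slice of size 1, matching the initial
   context [(1, 0)]. *)
have ls : lockstep P ly sigma tau.
  exists (1, 0), [::]; rewrite sstkE tstkE; split=> //; last exact: FramesNil.
  have [f sf] := wf_start (st_cfg st).
  rewrite spcE tpcE (fold_entry fold) sf.
  by apply: slot_fentry => //; apply: Or31.
have [tau' tsteps ls'] := lockstep_nsteps st fold ls steps.
by exists tau'; split=> //; apply: lockstep_sim ls'.
Qed.
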